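(* Let $T\in(0,\infty)$, let $l:[0,T]\times[0,T]\to\mathbf{R}$ be a bounded measurable function with $l(t,s)=0$ whenever $s>t$, and put $y(t,u):=1-\int_u^t l(s,u)\,ds$ for $t,u\in[0,T]$. Let $r,b\in\mathbf{R}$ and $\sigma\in(0,\infty)$. Let $\{\xi_i\}_{i=1}^\infty$ be i.i.d. random variables with $P(\xi_1=1)=P(\xi_1=-1)=1/2$. For $N\in\mathbf{N}$ and $n=1,\dots,\lfloor NT\rfloor$ put $$d_n:=\frac{\sigma}{\sqrt N}\sum_{i=1}^{n-1}\left\{y(\tfrac nN,\tfrac iN)-y(\tfrac{n-1}N,\tfrac iN)\right\}\xi_i-\frac{\sigma}{\sqrt N},$$ $$u_n:=\frac{\sigma}{\sqrt N}\sum_{i=1}^{n-1}\left\{y(\tfrac nN,\tfrac iN)-y(\tfrac{n-1}N,\tfrac iN)\right\}\xi_i+\frac{\sigma}{\sqrt N},$$ and let $$P_N:=P\left(\bigcup_{n=1}^{\lfloor NT\rfloor}\left\{d_n<\frac rN-\frac bN<u_n\right\}^{c}\right).$$ Then there exists a positive constant $C'=C'_T$ (depending on $T$) such that, for each $\alpha\in(0,1)$, there is $N(\alpha)\in\mathbf{N}$ satisfying $$P_N\le\frac{C'}{N^{\alpha}}\qquad(N\ge N(\alpha)).$$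
   Context: $\lfloor x\rfloor$ is the greatest integer not exceeding $x$; an empty sum is $0$ (so $d_1=-\sigma/\sqrt N$, $u_1=\sigma/\sqrt N$); $A^c$ denotes the complement of the event $A$. Interpretation: $P_N$ is the arbitrage probability of the $\lfloor NT\rfloor$-period binary market with bond price $B_n=B_{n-1}(1+r/N)$, $B_0=1$, and stock price $S_n=S_{n-1}(1+b/N+X_n)$, $S_0=s_0>0$, where, given $\xi_1,\dots,\xi_{n-1}$, the variable $X_n$ takes the two values $d_n$ (if $\xi_n=-1$) and $u_n$ (if $\xi_n=1$). *)

(* Defs.v *)
From HB Require Import structures.
From mathcomp Require Import all_boot all_order all_algebra.
From mathcomp Require Import finmap.
From mathcomp Require Import all_classical all_reals all_analysis.

Set Implicit Arguments.
Unset Strict Implicit.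
Unset Printing Implicit Defensive.

Import Order.TTheory GRing.Theory Num.Theory.
Import numFieldNormedType.Exports.

Local Open Scope classical_set_scope.
Local Open Scope ring_scope.

Section iid.
Context (R : realType) (d : measure_display) (Omega : measurableType d)
  (P : probability Omega R).
Implicit Types (I : set nat) (X : nat -> {RV P >-> R}).

Definition mutually_independent I X : Prop :=
  forall (J : {fset nat}) (B : nat -> set R),
    [set` J] `<=` I ->
    (forall i, i \in J -> measurable (B i)) ->
    P (\bigcap_(i in [set` J]) X i @^-1` B i)
      = (\prod_(i <- J) P (X i @^-1` B i))%E.

Definition identically_distributed I X : Prop :=
  forall i j, I i -> I j -> forall B : set R, measurable B ->
    distribution P (X i) B = distribution P (X j) B.

Definition iid I X : Prop :=
  mutually_independent I X /\ identically_distributed I X.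

End iid.

Section market.
Context (R : realType).

Definition oriented_integral (a b : R) (f : R -> R) : R :=
  if a <= b then \int[lebesgue_measure]_(s in `[a, b]) f s
  else - \int[lebesgue_measure]_(s in `[b, a]) f s.

(* The function y(t, u) = 1 - int_u^t l(s, u) ds. *)
Definition memory_kernel (l : R -> R -> R) (t u : R) : R :=
  1 - oriented_integral u t (fun s => l s u).

Context (Omega : Type) (l : R -> R -> R) (sigma : R) (xi : nat -> Omega -> R).

(* The driving sequence is indexed from 1; the value xi 0 is never used. *)
Definition memory_term (N n : nat) (w : Omega) : R :=
  sigma / Num.sqrt N%:R *
  \sum_(1 <= i < n)
    (memory_kernel l (n%:R / N%:R) (i%:R / N%:R)
     - memory_kernel l ((n%:R - 1) / N%:R) (i%:R / N%:R)) * xi i w.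

Definition down_return (N n : nat) (w : Omega) : R :=
  memory_term N n w - sigma / Num.sqrt N%:R.

Definition up_return (N n : nat) (w : Omega) : R :=
  memory_term N n w + sigma / Num.sqrt N%:R.

(* With bond return r / N and stock return b / N + X_n, where X_n takes the
   values d_n and u_n, period n is arbitrage-free iff d_n < (r - b) / N < u_n. *)
Definition no_arbitrage_event (r b : R) (N n : nat) : set Omega :=
  [set w | down_return N n w < r / N%:R - b / N%:R < up_return N n w].

Definition arbitrage_event (T r b : R) (N : nat) : set Omega :=
  \bigcup_(n in [set n : nat | (1 <= n)%N /\ n%:Z <= Num.floor (N%:R * T)])
    ~` no_arbitrage_event r b N n.

End market.

(* Main.v *)
Require Import Defs.
From HB Require Import structures.
From mathcomp Require Import all_boot all_order all_algebra.
From mathcomp Require Import finmap.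
From mathcomp Require Import all_classical all_reals all_analysis.
From mathcomp Require Import measurable_realfun ring lra.

Set Implicit Arguments.
Unset Strict Implicit.
Unset Printing Implicit Defensive.

Import Order.TTheory GRing.Theory Num.Theory.
Import numFieldNormedType.Exports.

Local Open Scope classical_set_scope.
Local Open Scope ring_scope.

(* Once [sigma * sqrt N >= 2 * |r - b|], an arbitrage in period [n] forces
   [|sum_i a_i xi_i| >= 1/2], where the weight [a_i], an increment of [y] over a
   time step of length [1 / N], is at most [sup |l| / N] in absolute value.  The
   fourth moment of this sum is at most [3 * (sum_i a_i ^ 2) ^ 2 = O(N ^ -2)],
   and summing Markov's inequality over the at most [N T] periods gives
   [P_N = O(1 / N)], which is stronger than the bound for every [alpha < 1]. *)

(** * Tail bound for weighted sums of independent random signs *)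

Section rademacher.
Context (R : realType) (d : measure_display) (Omega : measurableType d)
  (P : probability Omega R) (xi : nat -> {RV P >-> R}).

(** Coding the two values as [(-1) ^+ e] turns a pattern of signs into a boolean function, which is
    what [cylinder] takes. *)
Definition rademacher : Prop :=
  mutually_independent [set i : nat | (1 <= i)%N] xi /\
  forall i (e : bool), (1 <= i)%N ->
    P (xi i @^-1` [set (-1) ^+ e]) = (2^-1)%:E.

Lemma iid_rademacher :
  iid [set i : nat | (1 <= i)%N] xi ->
  P (xi 1%N @^-1` [set 1]) = (2^-1)%:E ->
  P (xi 1%N @^-1` [set -1]) = (2^-1)%:E ->
  rademacher.
Proof.
move=> [indep same] up down; split => // i e i_ge1.
have := same i 1%N i_ge1 isT _ (measurable_set1 ((-1) ^+ e)).
by rewrite /distribution /pushforward => ->; case: e; rewrite ?expr1 ?expr0.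
Qed.

Definition cylinder (J : {fset nat}) (e : nat -> bool) : set Omega :=
  \bigcap_(i in [set` J]) xi i @^-1` [set (-1) ^+ e i].

(** The shift [s] collects the summands already peeled off, whose signs are fixed by a cylinder
    event. *)
Definition large_sum (a : nat -> R) (c s : R) (m : nat) : set Omega :=
  [set w | c <= (s + \sum_(1 <= i < m.+1) a i * xi i w) ^+ 4].

Lemma measurable_sign i (e : bool) : measurable (xi i @^-1` [set (-1) ^+ e]).
Proof. exact: measurable_funPTI. Qed.

Lemma measurable_cylinder J e : measurable (cylinder J e).
Proof.
apply: fin_bigcap_measurable => [|i _]; first exact: finite_fset.
exact: measurable_sign.
Qed.

Lemma measurable_weighted_sum (a : nat -> R) m n :
  measurable_fun setT (fun w => \sum_(m <= i < n) a i * xi i w).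
Proof.
apply: measurable_sum => i; apply: measurable_funM => //.
Qed.

Lemma measurable_large_sum a c s m : measurable (large_sum a c s m).
Proof.
rewrite -[X in measurable X]setTI; apply: measurable_fun_le => //.
apply: measurable_funX; apply: measurable_funD => //.
exact: measurable_weighted_sum.
Qed.

Hypothesis xiP : rademacher.

Lemma cylinder_prob (J : {fset nat}) e :
  (forall i, i \in J -> (1 <= i)%N) -> P (cylinder J e) = (2^-1 ^+ #|` J|)%:E.
Proof.
move=> J_ge1; rewrite (xiP.1 J (fun i => [set (-1) ^+ e i])) //.
rewrite big_seq_cond (eq_bigr (fun=> (2^-1)%:E)); last first.
  by move=> i /andP[iJ _]; rewrite xiP.2// J_ge1.
rewrite -big_seq_cond prodEFin; congr EFin.
by rewrite big_const_seq count_predT iter_mulr_1.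
Qed.

(** The two values carry mass [1/2 + 1/2 = 1]. Since [xi i] is only almost surely a sign, the
    exceptional set has to be discarded each time a summand is peeled off. *)
Lemma sign_ae i : (1 <= i)%N ->
  P (~` (xi i @^-1` [set 1] `|` xi i @^-1` [set -1])) = 0%E.
Proof.
move=> i_ge1; have mp := measurable_sign i false; have mn := measurable_sign i true.
rewrite expr0 in mp; rewrite expr1 in mn.
set A := _ @^-1` [set 1]; set B := _ @^-1` [set -1].
have PU : P (A `|` B) = (P A + P B)%E.
  apply: measureU => //; apply/seteqP; split => // w [].
  rewrite /A /B /= => -> /eqP.
  by rewrite eq_sym lt_eqF//; lra.
rewrite probability_setC; last exact: measurableU.
have := xiP.2 i false i_ge1; have := xiP.2 i true i_ge1; rewrite PU expr0 expr1.
move=> -> ->; rewrite -EFinD (_ : 2^-1 + 2^-1 = 1); last by lra.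
by rewrite subrr.
Qed.

(* Conditioning on the later signs lets the induction peel off the last summand;
   [s ^+ 4 + 6 * s ^+ 2 * v + 3 * v ^+ 2], with [v] the variance of the sum,
   dominates its fourth moment about [- s]. *)
Lemma large_sum_cylinder_le a c m : 0 < c ->
  forall (J : {fset nat}) e s, (forall i, i \in J -> (m < i)%N) ->
  let v := \sum_(1 <= i < m.+1) a i ^+ 2 in
  (P (large_sum a c s m `&` cylinder J e)
    <= (2^-1 ^+ #|` J| * ((s ^+ 4 + 6 * s ^+ 2 * v + 3 * v ^+ 2) / c))%:E)%E.
Proof.
move=> c_gt0; elim: m => [|m IH] J e s J_gt /=; set v := \sum_(_ <= i < _) _.
  have mC := measurable_cylinder J e.
  have PC : P (cylinder J e) = (2^-1 ^+ #|` J|)%:E by exact: cylinder_prob.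
  have p_ge0 : 0 <= 2^-1 ^+ #|` J| :> R by rewrite exprn_ge0// invr_ge0.
  have v0 : v = 0 by rewrite /v big_geq.
  rewrite v0 expr0n !mulr0 !addr0.
  (* With no summand left the event is everything or empty, according to whether [s ^+ 4 / c] is at
     least [1]. *)
  have [le_cs|lt_sc] := leP c (s ^+ 4).
    apply: (@le_trans _ _ (P (cylinder J e))).
      by apply: le_measure; rewrite ?inE//; apply: measurableI => //;
        exact: measurable_large_sum.
    by rewrite PC lee_fin ler_peMr// ler_pdivlMr// mul1r.
  rewrite (_ : large_sum a c s 0 = set0) ?set0I ?measure0 ?lee_fin.
    by rewrite mulr_ge0// divr_ge0 ?(ltW c_gt0)// exprn_even_ge0.
  apply/seteqP; split => // w; rewrite /large_sum/= big_geq// addr0.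
  by rewrite leNgt lt_sc.
have mJ : m.+1 \notin J by apply/negP => /J_gt; rewrite ltnn.
pose J' := (m.+1 |` J)%fset.
have J'_gt i : i \in J' -> (m < i)%N.
  by rewrite in_fset1U => /orP[/eqP ->//|/J_gt /ltnW].
have cardJ' : #|` J'| = #|` J|.+1 by rewrite cardfsU1 mJ.
(* Splitting on the sign of [xi m.+1] adds [m.+1] to the prescribed indices and moves
   [a m.+1 * (-1) ^+ b] into the shift; [Z] is the null set where [xi m.+1] is not a sign. *)
pose e' (b : bool) := [eta e with m.+1 |-> b].
pose A (b : bool) := large_sum a c (s + a m.+1 * (-1) ^+ b) m `&` cylinder J' (e' b).
pose Z := ~` (xi m.+1 @^-1` [set 1] `|` xi m.+1 @^-1` [set -1]).
have mA b : measurable (A b).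
  apply: measurableI; first exact: measurable_large_sum.
  exact: measurable_cylinder.
have mZ : measurable Z.
  by apply: measurableC; apply: measurableU; exact: measurable_funPTI.
have sub : large_sum a c s m.+1 `&` cylinder J e `<=` A false `|` A true `|` Z.
  move=> w [Lw Cw]; have [xw|] := pselect ((xi m.+1 @^-1` [set 1] `|`
    xi m.+1 @^-1` [set -1]) w); last by right.
  left; have Aw (b : bool) : xi m.+1 w = (-1) ^+ b -> A b w.
    move=> xb; split.
      move: Lw; rewrite /large_sum/= big_nat_recr//= xb.
      by rewrite -addrA [X in s + X]addrC.
    move=> i /=; rewrite in_fset1U /e' /= => /orP[/eqP ->|iJ].
      by rewrite eqxx.
    have := Cw i iJ => /= ->; case: eqP => // im.
    by move: mJ; rewrite -im iJ.
  case: xw => /= xw; [left; apply: Aw|right; apply: Aw].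
  - by rewrite expr0.
  - by rewrite expr1.
have mAA : measurable (A false `|` A true) by exact: measurableU.
apply: (@le_trans _ _ (P (A false `|` A true `|` Z))).
  apply: le_measure sub; rewrite inE; last exact: measurableU.
  by apply: measurableI; [exact: measurable_large_sum|exact: measurable_cylinder].
have UZ : (P (A false `|` A true `|` Z) <= P (A false `|` A true) + P Z)%E.
  exact: measureU2.
have UA : (P (A false `|` A true) <= P (A false) + P (A true))%E.
  exact: measureU2.
apply: (le_trans UZ); rewrite sign_ae// adde0; apply: (le_trans UA).
have IHA (b : bool) := IH J' (e' b) (s + a m.+1 * (-1) ^+ b) J'_gt.
apply: (le_trans (leeD (IHA false) (IHA true))).
rewrite -EFinD lee_fin cardJ' exprS /v [in leRHS]big_nat_recr//=.
set u := \sum_(1 <= i < m.+1) _; rewrite expr0 expr1 mulr1 mulrN1.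
rewrite -mulrA -[(2^-1 * _ ^+ _) * _ in X in _ + X]mulrA -!mulrDr.
rewrite [leLHS]mulrCA ler_wpM2l ?exprn_ge0 ?invr_ge0//.
rewrite -mulrDl mulrA ler_wpM2r ?invr_ge0 ?(ltW c_gt0)//.
(* Averaging the two bounds, at shifts [s + x] and [s - x] with [x = a m.+1], cancels the odd powers
   of [x]. The result falls short of the bound with variance [u + x ^+ 2] by exactly
   [2 * x ^+ 4]. *)
have : 0 <= a m.+1 ^+ 4 by rewrite exprn_even_ge0.
move: (a m.+1) => x; clear; nra.
Qed.

(** This is the case of zero shift and no prescribed sign. *)
Lemma fourth_moment_tail a c m : 0 < c ->
  (P [set w | (c <= (\sum_(1 <= i < m.+1) a i * xi i w) ^+ 4)%R]
    <= (3 * (\sum_(1 <= i < m.+1) a i ^+ 2) ^+ 2 / c)%:E)%E.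
Proof.
move=> c_gt0.
have := @large_sum_cylinder_le a c m c_gt0 fset0 (fun=> false) 0.
rewrite cardfs0 /= expr0 mul1r !expr0n/= mulr0 mul0r !add0r.
rewrite /cylinder /large_sum set_fset0 bigcap_set0 setIT.
by under eq_set do rewrite add0r; apply.
Qed.

End rademacher.

(** * Time increments of the memory kernel *)

Lemma bounded_measurable_integrable_itv (R : realType) (f : R -> R) (M p q : R) :
  measurable_fun `[p, q] f -> (forall s, s \in `[p, q] -> `|f s| <= M) ->
  lebesgue_measure.-integrable `[p, q] (EFin \o f).
Proof.
move=> mf fM; have fin : (lebesgue_measure (`[p, q]%classic : set R) < +oo)%E.
  by rewrite lebesgue_measure_itv/=; case: ifP => // _; rewrite -EFinB ltry.
apply: measurable_bounded_integrable => //.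
exists M; split; first exact: num_real.
by move=> x Mx s /= /fM /le_trans; apply; exact: ltW.
Qed.

(** As [u <= p <= q], both oriented integrals are ordinary ones starting at [u], so their difference
    is the integral of [l^~ u] over []p, q]]. *)
Lemma memory_kernel_increment (R : realType) (l : R -> R -> R) (M u p q : R) :
  u <= p -> p <= q -> measurable_fun `[u, q] (l^~ u) ->
  (forall s, s \in `[u, q] -> `|l s u| <= M) ->
  `|memory_kernel l q u - memory_kernel l p u| <= M * (q - p).
Proof.
move=> up pq ml lM; have uq := le_trans up pq.
have il := bounded_measurable_integrable_itv ml lM.
have sub : `[p, q] `<=` `[u, q].
  by apply: subset_itv; rewrite bnd_simp.
have il' : lebesgue_measure.-integrable `[p, q] (EFin \o l^~ u).
  exact: integrableS il.
rewrite /memory_kernel /oriented_integral uq up.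
rewrite opprB addrC addrA addrNK.
rewrite distrC Rintegral_itvB ?bnd_simp// Rintegral_itv_obnd_cbnd; last first.
  apply: integrableS il' => //; exact: subset_itv_oc_cc.
apply: (le_trans (le_normr_Rintegral _ il')) => //.
apply: (@le_trans _ _ (\int[lebesgue_measure]_(s in `[p, q]) M)).
  apply: le_Rintegral => //.
  - exact: integrable_norm.
  - exact: (@bounded_measurable_integrable_itv _ (cst M) `|M| p q).
  - by move=> s /sub /lM.
have <- : fine (lebesgue_measure (`[p, q]%classic : set R)) = q - p.
  by rewrite lebesgue_measure_itv/= lte_fin; case: ltgtP pq => // -> _; rewrite subrr.
by rewrite Rintegral_cst.
Qed.

(** * Arbitrage probability in a single period *)

Section period.
Context (R : realType) (T : R) (l : R -> R -> R) (r b sigma M : R)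
  (d : measure_display) (Omega : measurableType d) (P : probability Omega R)
  (xi : nat -> {RV P >-> R}).

Lemma measurable_no_arbitrageC N n :
  measurable (~` no_arbitrage_event l sigma xi r b N n).
Proof.
have mS : measurable_fun setT (memory_term l sigma xi N n).
  apply: measurable_funM => //; exact: measurable_weighted_sum.
set c := r / N%:R - b / N%:R.
rewrite (_ : ~` _ = [set w | c <= down_return l sigma xi N n w] `|`
                    [set w | up_return l sigma xi N n w <= c]).
  apply: measurableU; rewrite -[X in measurable X]setTI.
  - by apply: measurable_fun_le => //; apply: measurable_funB.
  - by apply: measurable_fun_le => //; apply: measurable_funD.
apply/seteqP; split=> w; rewrite /no_arbitrage_event /= -/c.
  by move=> /negP; rewrite negb_and -!leNgt => /orP.
by move=> /orP H; apply/negP; rewrite negb_and -!leNgt.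
Qed.

(** Divided by [sigma / sqrt N], the no-arbitrage condition reads [S - 1 < x < S + 1] with
    [x = (r - b) / (sigma * sqrt N)]. As [|x| <= 1/2], its failure forces [|S| >= 1/2], and [16^-1]
    is the fourth power of [1/2]. *)
Lemma arbitrage_large_sum N n w : 0 < sigma -> (0 < N)%N ->
    2 * `|r - b| <= sigma * Num.sqrt N%:R ->
    (~` no_arbitrage_event l sigma xi r b N n) w ->
  16^-1 <= (\sum_(1 <= i < n)
    (memory_kernel l (n%:R / N%:R) (i%:R / N%:R)
     - memory_kernel l ((n%:R - 1) / N%:R) (i%:R / N%:R)) * xi i w) ^+ 4.
Proof.
move=> s_gt0 N_gt0 N_large; set S := \sum_(_ <= _ < _) _.
set q := Num.sqrt (N%:R : R) in N_large *.
have q_gt0 : 0 < q by rewrite sqrtr_gt0 ltr0n.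
have Nq : N%:R = q ^+ 2 :> R by rewrite sqr_sqrtr.
pose x := (r - b) / (sigma * q).
have sq_gt0 : 0 < sigma * q by exact: mulr_gt0.
have x_small : `|x| <= 2^-1.
  rewrite /x normrM normfV (gtr0_norm sq_gt0) ler_pdivrMr//; lra.
have cE : r / N%:R - b / N%:R = sigma / q * x.
  by rewrite Nq /x; field; rewrite !gt_eqF.
have dE : down_return l sigma xi N n w = sigma / q * (S - 1).
  by rewrite mulrBr mulr1.
have uE : up_return l sigma xi N n w = sigma / q * (S + 1).
  by rewrite mulrDr mulr1.
have sq' : 0 < sigma / q by exact: divr_gt0.
rewrite /no_arbitrage_event /= cE dE uE !ltr_pM2l// => /negP.
rewrite negb_and -!leNgt => H.
have : 4^-1 <= S ^+ 2.
  move: x_small; rewrite ler_norml => /andP[]; case/orP: H => ? ? ?; nra.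
rewrite (_ : S ^+ 4 = (S ^+ 2) ^+ 2); last by rewrite -exprM.
move: (S ^+ 2) => y; nra.
Qed.

Hypotheses (M_ge0 : 0 <= M)
  (lM : forall t s, t \in `[0, T] -> s \in `[0, T] -> `|l t s| <= M)
  (ml : forall u, u \in `[0, T] -> measurable_fun `[0, T] (l^~ u)).

(** Each of the [n <= N * T] increments spans a time step [1 / N], hence has square at most
    [(M / N) ^+ 2]. *)
Lemma increment_sqr_sum N n : (0 < N)%N -> n.+1%:R <= N%:R * T ->
  \sum_(1 <= i < n.+1)
    (memory_kernel l (n.+1%:R / N%:R) (i%:R / N%:R)
     - memory_kernel l ((n.+1%:R - 1) / N%:R) (i%:R / N%:R)) ^+ 2
  <= T * M ^+ 2 / N%:R.
Proof.
move=> N_gt0 nNT; have N0 : 0 < N%:R :> R by rewrite ltr0n.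
have qT : n.+1%:R / N%:R <= T by rewrite ler_pdivrMr// mulrC.
have pE : (n.+1%:R - 1) / N%:R = n%:R / N%:R :> R by rewrite -natr1 addrK.
apply: (@le_trans _ _ (\sum_(1 <= i < n.+1) (M / N%:R) ^+ 2)).
  apply: ler_sum_nat => i /andP[i_gt0 i_le].
  have u_ge0 : 0 <= i%:R / N%:R :> R by rewrite divr_ge0.
  have up : i%:R / N%:R <= n%:R / N%:R :> R by rewrite ler_pM2r ?invr_gt0// ler_nat.
  have pq : n%:R / N%:R <= n.+1%:R / N%:R :> R.
    by rewrite ler_pM2r ?invr_gt0// ler_nat.
  have uT : i%:R / N%:R \in `[0, T].
    by rewrite in_itv/= u_ge0 (le_trans up (le_trans pq qT)).
  have sub s : s \in `[i%:R / N%:R, n.+1%:R / N%:R] -> s \in `[0, T].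
    rewrite !in_itv/= => /andP[us sq].
    by rewrite (le_trans u_ge0 us) (le_trans sq qT).
  rewrite -real_normK ?num_real// ler_sqr ?nnegrE ?divr_ge0// pE.
  rewrite (_ : M / _ = M * (n.+1%:R / N%:R - n%:R / N%:R)); last first.
    by rewrite -mulrBl -natr1 addrAC subrr add0r mul1r.
  apply: memory_kernel_increment => //.
  - by apply: measurable_funS (ml uT) => //; exact: sub.
  - by move=> s /sub sT; exact: lM.
rewrite sumr_const_nat subn1/= -[_ *+ n]mulr_natl.
have -> : n%:R * (M / N%:R) ^+ 2 = n%:R / N%:R * (M ^+ 2 / N%:R).
  by field; rewrite gt_eqF.
rewrite -[leRHS]mulrA ler_wpM2r ?divr_ge0 ?exprn_even_ge0//.
by apply: le_trans qT; rewrite ler_pM2r ?invr_gt0// ler_nat.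
Qed.

Lemma period_arbitrage_prob N n : rademacher xi -> 0 < sigma -> (0 < N)%N ->
    2 * `|r - b| <= sigma * Num.sqrt N%:R -> n.+1%:R <= N%:R * T ->
  (P (~` no_arbitrage_event l sigma xi r b N n.+1)
    <= (48 * T ^+ 2 * M ^+ 4 / N%:R ^+ 2)%:E)%E.
Proof.
move=> xiP s_gt0 N_gt0 N_large nNT.
pose a i := memory_kernel l (n.+1%:R / N%:R) (i%:R / N%:R)
     - memory_kernel l ((n.+1%:R - 1) / N%:R) (i%:R / N%:R).
have c_gt0 : 0 < 16^-1 :> R by rewrite invr_gt0.
have tail := fourth_moment_tail xiP a n c_gt0.
apply: le_trans; last apply: (le_trans tail).
  apply: le_measure; rewrite ?inE.
  - exact: measurable_no_arbitrageC.
  - rewrite -[X in measurable X]setTI; apply: measurable_fun_le => //.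
    by apply: measurable_funX; exact: measurable_weighted_sum.
  - by move=> w; exact: arbitrage_large_sum.
rewrite lee_fin invrK.
have N0 : 0 < N%:R :> R by rewrite ltr0n.
have := increment_sqr_sum N_gt0 nNT.
rewrite -/a; set v := \sum_(_ <= _ < _) _ => v_le.
have v_ge0 : 0 <= v by apply: sumr_ge0 => i _; exact: sqr_ge0.
(* The constant [48] is the moment factor [3] times the inverse threshold [16]. *)
have -> : 48 * T ^+ 2 * M ^+ 4 / N%:R ^+ 2 = 3 * (T * M ^+ 2 / N%:R) ^+ 2 * 16.
  by field; rewrite gt_eqF.
by rewrite ler_pM2r// ler_pM2l// ler_sqr ?nnegrE// (le_trans v_ge0).
Qed.

End period.

(** * Union bound over all periods *)

Theorem theorem4p2 (R : realType) (T : R) (T_gt0 : 0 < T)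
    (l : R -> R -> R)
    (l_bounded : [bounded l p.1 p.2 | p in `[0, T] `*` `[0, T]])
    (l_measurable : measurable_fun (`[0, T] `*` `[0, T])
                      (fun p : R * R => l p.1 p.2))
    (l_causal : forall t s, t \in `[0, T] -> s \in `[0, T] -> t < s ->
                  l t s = 0)
    (r b sigma : R) (sigma_gt0 : 0 < sigma)
    (d : measure_display) (Omega : measurableType d) (P : probability Omega R)
    (xi : nat -> {RV P >-> R})
    (xi_iid : iid [set i : nat | (1 <= i)%N] xi)
    (xi_up : P (xi 1%N @^-1` [set 1]) = (2^-1)%:E)
    (xi_down : P (xi 1%N @^-1` [set -1]) = (2^-1)%:E) :
  exists2 C' : R, 0 < C' &
    forall alpha : R, 0 < alpha < 1 ->
      exists2 N_alpha : nat, (1 <= N_alpha)%N &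
        forall N : nat, (N_alpha <= N)%N ->
          (P (arbitrage_event l sigma xi T r b N) <= (C' / N%:R `^ alpha)%:E)%E.
Proof.
have xiP := iid_rademacher xi_iid xi_up xi_down.
have [M M_gt0 lM] : exists2 M : R, 0 < M &
    forall t s, t \in `[0, T] -> s \in `[0, T] -> `|l t s| <= M.
  (* Boundedness supplies a bound for every number strictly above [M0], which may be negative. *)
  case: l_bounded => M0 [_ lM0]; exists (`|M0| + 1).
    by rewrite ltr_wpDl.
  move=> t s tT sT; apply: (lM0 _ _ (t, s)) => //.
  by rewrite ltr_pwDr// ler_norm.
have ml u : u \in `[0, T] -> measurable_fun `[0, T] (l^~ u).
  move=> uT; apply: (measurable_comp (F := `[0, T] `*` `[0, T])
    (f := fun p : R * R => l p.1 p.2) (g := fun s => (s, u))) => //.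
  - exact: measurableX.
  - by move=> _ [s sT <-].
  - exact: (measurable_funTS (pair2_measurable u)).
have C_gt0 : 0 < 48 * T ^+ 3 * M ^+ 4 by rewrite !mulr_gt0 ?exprn_gt0.
(* The one-period bound [48 * T ^+ 2 * M ^+ 4 / N ^+ 2] times at most [N * T] periods gives this
   constant over [N]. *)
exists (48 * T ^+ 3 * M ^+ 4) => // alpha /andP[_ alpha_lt1].
pose x := 2 * `|r - b| / sigma.
(* The threshold exceeds [x ^+ 2], so [x <= sqrt N]; it is the same for all [alpha]. *)
exists (Num.truncn (x ^+ 2)).+1 => // N N_ge.
have N_gt0 : (0 < N)%N by exact: leq_trans N_ge.
have N0 : 0 < N%:R :> R by rewrite ltr0n.
have N_large : 2 * `|r - b| <= sigma * Num.sqrt N%:R.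
  rewrite [leRHS]mulrC -ler_pdivrMr// -/x.
  have x_ge0 : 0 <= x by rewrite !mulr_ge0 ?invr_ge0// ltW.
  rewrite -[x]ger0_norm// -sqrtr_sqr ler_wsqrtr//.
  by apply: (le_trans (ltW (truncnS_gt _))); rewrite ler_nat.
pose K := Num.truncn (N%:R * T).
pose A n := ~` no_arbitrage_event l sigma xi r b N n.+1.
have NT_ge0 : 0 <= N%:R * T by rewrite mulr_ge0 ?ltW.
have K_le : K%:R <= N%:R * T by rewrite truncn_le.
have mA n : measurable (A n) by exact: measurable_no_arbitrageC.
(* Periods [1, ..., floor (N * T)] become indices [0, ..., K - 1]; floor and truncation agree
   because [N * T >= 0]. *)
have sub : arbitrage_event l sigma xi T r b N `<=` \big[setU/set0]_(n < K) A n.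
  move=> w [n /= [n_gt0 n_le] Aw]; rewrite -bigcup_mkord.
  exists n.-1; last by rewrite /A prednK.
  by rewrite /= prednK// truncn_ge_nat// pmulrn -floor_ge_int.
have mE : measurable (arbitrage_event l sigma xi T r b N).
  by apply: bigcup_measurable => n _; exact: measurable_no_arbitrageC.
have union_bound : (P (arbitrage_event l sigma xi T r b N)
    <= \sum_(n < K) P (A n))%E by exact: content_subadditive.
apply: (le_trans union_bound).
apply: (@le_trans _ _ (\sum_(n < K) (48 * T ^+ 2 * M ^+ 4 / N%:R ^+ 2)%:E)%E).
  apply: lee_sum => n _; apply: period_arbitrage_prob => //; first exact: ltW.
  by apply: le_trans K_le; rewrite ler_nat.
rewrite sumEFin lee_fin sumr_const card_ord -[_ *+ K]mulr_natl.
apply: (@le_trans _ _ (48 * T ^+ 3 * M ^+ 4 / N%:R)).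
  have -> : 48 * T ^+ 3 * M ^+ 4 / N%:R
      = N%:R * T * (48 * T ^+ 2 * M ^+ 4 / N%:R ^+ 2).
    by field; rewrite gt_eqF.
  by rewrite ler_wpM2r// !mulr_ge0 ?invr_ge0 ?exprn_ge0// ltW.
(* What remains is [N ^ alpha <= N], true for [N >= 1] and [alpha < 1]. *)
rewrite ler_pM2l// lef_pV2 ?posrE ?powR_gt0//.
by rewrite -[leRHS]powRr1 ?ler0n// ler_powR ?ler1n// ltW.
Qed.
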